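(* Let $\mathbf{C}$ be a 2-category, $C,C'$ pseudo-categories in $\mathbf{C}$, and $F,G,H,F',G',H':C\to C'$ pseudo-functors. Let $T=(t,\tau):F\to G$, $S=(s,\sigma):G\to H$, $T'=(t',\tau'):F'\to G'$, $S'=(s',\sigma'):G'\to H'$ be pseudo-natural transformations and $\theta:F\to F'$, $\theta':G\to G'$, $\theta'':H\to H'$ natural transformations. Let $\Phi$ be a pseudo-modification from $T$ to $T'$ with boundary $(\theta,\theta')$ and $\Psi$ a pseudo-modification from $S$ to $S'$ with boundary $(\theta',\theta'')$. Then the formula $$\Psi\otimes\Phi=m'\langle\Psi,\Phi\rangle$$ for the pseudo-composition of pseudo-modifications is well defined, i.e. $m'\langle\Psi,\Phi\rangle$ is a pseudo-modification from $S\otimes T$ to $S'\otimes T'$ with boundary $(\theta,\theta'')$.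
   Context: Conventions. In a 2-category $\mathbf{C}$, $\circ$ (or juxtaposition) denotes composition of morphisms, horizontal composition of 2-cells and whiskering; $\cdot$ denotes vertical composition of 2-cells ($\beta\cdot\alpha$ means first $\alpha$, then $\beta$). All pullbacks mentioned are assumed to exist and are strict pullbacks in the 2-categorical sense (universal also for 2-cells), so that $\langle -,-\rangle$ denotes the induced morphism or 2-cell into a pullback (a morphism inside a pairing with a 2-cell stands for its identity 2-cell). For $d,c:C_1\to C_0$, the pullback $C_1\times_{C_0}C_1$ has projections $\pi_1,\pi_2$ with $d\pi_1=c\pi_2$; similarly for triple and quadruple pullbacks. We write $f\times g$ (with or without subscript) for $\langle f\pi_1,g\pi_2\rangle$, etc. Pseudo-category. A pseudo-category in $\mathbf{C}$ is a system $C=(C_0,C_1,d,c,e,m,\alpha,\lambda,\rho)$ where $C_0,C_1$ are objects, $d,c:C_1\to C_0$, $e:C_0\to C_1$, $m:C_1\times_{C_0}C_1\to C_1$ are morphisms, and $\alpha:m(1_{C_1}\times_{C_0}m)\to m(m\times_{C_0}1_{C_1})$, $\lambda:m\langle ec,1_{C_1}\rangle\to 1_{C_1}$, $\rho:m\langle 1_{C_1},ed\rangle\to 1_{C_1}$ are invertible 2-cells, such that - $de=1_{C_0}=ce$; $dm=d\pi_2$, $cm=c\pi_1$; - $d\circ\lambda=1_d=d\circ\rho$, $c\circ\lambda=1_c=c\circ\rho$; $d\circ\alpha=1_{d\pi_3}$, $c\circ\alpha=1_{c\pi_1}$; $\lambda\circ e=\rho\circ e$; - (pentagon) $(\alpha\circ(m\times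 1\times 1))\cdot(\alpha\circ(1\times 1\times m))=(m\circ(\alpha\times 1))\cdot(\alpha\circ(1\times m\times 1))\cdot(m\circ(1\times\alpha))$; - (triangle) $(m\circ(\rho\times 1))\cdot(\alpha\circ(1\times\langle ec,1\rangle))=m\circ(1\times\lambda)$. The structure of $C'$ is denoted by the same letters with primes. Pseudo-functor. A pseudo-functor $F:C\to C'$ is a system $F=(F_0,F_1,\mu_F,\varepsilon_F)$ with morphisms $F_0:C_0\to C_0'$, $F_1:C_1\to C_1'$ and invertible 2-cells $\mu=\mu_F:F_1m\to m'(F_1\times_{F_0}F_1)$, $\varepsilon=\varepsilon_F:F_1e\to e'F_0$ such that - $d'F_1=F_0d$, $c'F_1=F_0c$; $d'\circ\mu=1_{F_0d\pi_2}$, $c'\circ\mu=1_{F_0c\pi_1}$; $d'\circ\varepsilon=1_{F_0}=c'\circ\varepsilon$; - $(\alpha'\circ(F_1\times F_1\times F_1))\cdot(m'\circ(1_{F_1}\times\mu))\cdot(\mu\circ(1\times m))=(m'\circ(\mu\times 1_{F_1}))\cdot(\mu\circ(m\times 1))\cdot(F_1\circ\alpha)$; - $F_1\circ\rho=(\rho'\circ F_1)\cdot(m'\langle 1_{F_1},\varepsilon\circ d\rangle)\cdot(\mu\circ\langle 1,ed\rangle)$; - $F_1\circ\lambda=(\lambda'\circ F_1)\cdot(m'\langle\varepsilon\circ c,1_{F_1}\rangle)\cdot(\mu\circ\langle ec,1\rangle)$. Natural transformation. For pseudo-functors $F,G:C\to C'$, a natural transformation $\theta:F\to G$ is a pair $\theta=(\theta_0,\theta_1)$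 of 2-cells $\theta_0:F_0\to G_0$, $\theta_1:F_1\to G_1$ with $d'\circ\theta_1=\theta_0\circ d$, $c'\circ\theta_1=\theta_0\circ c$, $\mu_G\cdot(\theta_1\circ m)=(m'\circ(\theta_1\times_{\theta_0}\theta_1))\cdot\mu_F$ and $\varepsilon_G\cdot(\theta_1\circ e)=(e'\circ\theta_0)\cdot\varepsilon_F$. Pseudo-natural transformation. For pseudo-functors $F,G:C\to C'$, a pseudo-natural transformation $T:F\to G$ is a pair $T=(t,\tau)$ with $t:C_0\to C_1'$ a morphism and $\tau:m'\langle G_1,td\rangle\to m'\langle tc,F_1\rangle$ an invertible 2-cell such that - $d't=F_0$, $c't=G_0$; $d'\circ\tau=1_{d'F_1}$, $c'\circ\tau=1_{c'G_1}$; - $(\alpha'\langle tc\pi_1,F_1\pi_1,F_1\pi_2\rangle)\cdot(m'\langle tc\pi_1,\mu_F\rangle)\cdot(\tau\circ m)\cdot(m'\langle\mu_G^{-1},td\pi_2\rangle)=(m'\langle\tau\pi_1,F_1\pi_2\rangle)\cdot(\alpha'\langle G_1\pi_1,tc\pi_2,F_1\pi_2\rangle)\cdot(m'\langle G_1\pi_1,\tau\pi_2\rangle)\cdot(\alpha'^{-1}\langle G_1\pi_1,G_1\pi_2,td\pi_2\rangle)$; - $(\lambda'\circ t)\cdot(m'\langle\varepsilon_G,1_t\rangle)=(\rho'\circ t)\cdot(m'\langle 1_t,\varepsilon_F\rangle)\cdot(\tau\circ e)$. Vertical composition. For $T=(t,\tau):F\to G$ and $S=(s,\sigma):G\to H$,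 $S\otimes T=(m'\langle s,t\rangle,\sigma\otimes\tau):F\to H$ with $\sigma\otimes\tau=(\alpha'\langle sc,tc,F_1\rangle)\cdot(m'\langle 1_{sc},\tau\rangle)\cdot(\alpha'^{-1}\langle sc,G_1,td\rangle)\cdot(m'\langle\sigma,1_{td}\rangle)\cdot(\alpha'\langle H_1,sd,td\rangle)$. Pseudo-modification. Let $T=(t,\tau):F\to G$ and $T'=(t',\tau'):H\to K$ be pseudo-natural transformations and $\theta:F\to H$, $\theta':G\to K$ natural transformations. A pseudo-modification from $T$ to $T'$ with boundary $(\theta,\theta')$ is a 2-cell $\Phi:t\to t'$ of $\mathbf{C}$ with $d'\circ\Phi=\theta_0$, $c'\circ\Phi=\theta'_0$ and $\tau'\cdot(m'\langle\theta'_1,\Phi\circ d\rangle)=(m'\langle\Phi\circ c,\theta_1\rangle)\cdot\tau$. *)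

(* Defs.v *)
From Corelib Require Import ssreflect.

Set Implicit Arguments.
Unset Strict Implicit.
Unset Printing Implicit Defensive.

Declare Scope twocat_scope.
Delimit Scope twocat_scope with twocat.
Local Open Scope twocat_scope.

Reserved Notation "g ∘ f" (at level 40, left associativity).
Reserved Notation "b ∗ a" (at level 40, left associativity).
Reserved Notation "b • a" (at level 50, left associativity).
Reserved Notation "f ⇒ g" (at level 70, no associativity).
Reserved Notation "f ≅ g" (at level 70, no associativity).

(* Strict 2-categories.  Each hom-category is presented by a type [hom A B] of
   objects, a type [cell A B] of all its arrows, and source and target maps, so
   that 2-cells with propositionally equal boundaries compose and compare
   without transport.  Vertical composition is partial: it takes a proof of
   composability. *)
Record twoCategory := TwoCategory {
  ob :> Type;
  hom : ob -> ob -> Type;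
  cell : ob -> ob -> Type;
  src : forall {A B}, cell A B -> hom A B;
  tgt : forall {A B}, cell A B -> hom A B;
  id1 : forall A, hom A A;
  comp1 : forall {A B C}, hom B C -> hom A B -> hom A C;
  id2 : forall {A B}, hom A B -> cell A B;
  vcomp : forall {A B} (b a : cell A B), src b = tgt a -> cell A B;
  hcomp : forall {A B C}, cell B C -> cell A B -> cell A C;
  comp1A : forall A B C D (h : hom C D) (g : hom B C) (f : hom A B),
    comp1 h (comp1 g f) = comp1 (comp1 h g) f;
  comp1_idl : forall A B (f : hom A B), comp1 (id1 B) f = f;
  comp1_idr : forall A B (f : hom A B), comp1 f (id1 A) = f;
  src_id2 : forall A B (f : hom A B), src (id2 f) = f;
  tgt_id2 : forall A B (f : hom A B), tgt (id2 f) = f;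
  src_vcomp : forall A B (b a : cell A B) (p : src b = tgt a),
    src (vcomp p) = src a;
  tgt_vcomp : forall A B (b a : cell A B) (p : src b = tgt a),
    tgt (vcomp p) = tgt b;
  src_hcomp : forall A B C (b : cell B C) (a : cell A B),
    src (hcomp b a) = comp1 (src b) (src a);
  tgt_hcomp : forall A B C (b : cell B C) (a : cell A B),
    tgt (hcomp b a) = comp1 (tgt b) (tgt a);
  vcompA : forall A B (c b a : cell A B)
    (p : src b = tgt a) (q : src c = tgt b)
    (p' : src c = tgt (vcomp p)) (q' : src (vcomp q) = tgt a),
    vcomp p' = vcomp q';
  vcomp_idl : forall A B (a : cell A B) (p : src (id2 (tgt a)) = tgt a),
    vcomp p = a;
  vcomp_idr : forall A B (a : cell A B) (p : src a = tgt (id2 (src a))),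
    vcomp p = a;
  hcompA : forall A B C D (c : cell C D) (b : cell B C) (a : cell A B),
    hcomp c (hcomp b a) = hcomp (hcomp c b) a;
  hcomp_idl : forall A B (a : cell A B), hcomp (id2 (id1 B)) a = a;
  hcomp_idr : forall A B (a : cell A B), hcomp a (id2 (id1 A)) = a;
  hcomp_id2 : forall A B C (g : hom B C) (f : hom A B),
    hcomp (id2 g) (id2 f) = id2 (comp1 g f);
  interchange : forall A B C (b' b : cell B C) (a' a : cell A B)
    (q : src b' = tgt b) (p : src a' = tgt a)
    (r : src (hcomp b' a') = tgt (hcomp b a)),
    hcomp (vcomp q) (vcomp p) = vcomp r
}.

Arguments hom {t} A B.
Arguments cell {t} A B.
Arguments id1 {t A}.
Arguments comp1 {t A B C} g f : rename.
Arguments hcomp {t A B C} b a : rename.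
Arguments vcomp {t A B} b a p : rename.
Coercion id2 : hom >-> cell.

Notation "g ∘ f" := (comp1 g f) : twocat_scope.
Notation "b ∗ a" := (hcomp b a) : twocat_scope.
Notation "b • a" := (vcomp b a _) : twocat_scope.
Bind Scope twocat_scope with hom cell.

Record tcell (K : twoCategory) (A B : K) (f g : hom A B) := TCell {
  tc :> cell A B;
  tc_src : src tc = f;
  tc_tgt : tgt tc = g
}.
Notation "f ⇒ g" := (tcell f g) : twocat_scope.

Lemma tc_comp (K : twoCategory) (A B : K) (f g h : hom A B)
  (b : g ⇒ h) (a : f ⇒ g) : src b = tgt a.
Proof. by rewrite tc_src tc_tgt. Qed.

Record icell (K : twoCategory) (A B : K) (f g : hom A B) := ICell {
  ic :> f ⇒ g;
  icV : g ⇒ f;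
  icVl : vcomp icV ic (tc_comp icV ic) = id2 f;
  icVr : vcomp ic icV (tc_comp ic icV) = id2 g
}.
Notation "f ≅ g" := (icell f g) : twocat_scope.

Definition invertible (K : twoCategory) (A B : K) (f g : hom A B) (a : f ⇒ g) :=
  exists b : g ⇒ f,
    vcomp b a (tc_comp b a) = id2 f /\ vcomp a b (tc_comp a b) = id2 g.

(* Strict 2-categorical pullbacks, with a chosen mediating morphism and 2-cell. *)
Record pullback (K : twoCategory) (A B Z : K) (f : hom A Z) (g : hom B Z) :=
Pullback {
  pb :> ob K;
  pi1 : hom pb A;
  pi2 : hom pb B;
  pbE : f ∘ pi1 = g ∘ pi2;
  pair : forall X (x : hom X A) (y : hom X B), f ∘ x = g ∘ y -> hom X pb;
  pair_pi1 : forall X (x : hom X A) (y : hom X B) (p : f ∘ x = g ∘ y),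
    pi1 ∘ pair p = x;
  pair_pi2 : forall X (x : hom X A) (y : hom X B) (p : f ∘ x = g ∘ y),
    pi2 ∘ pair p = y;
  pair_uniq : forall X (u v : hom X pb),
    pi1 ∘ u = pi1 ∘ v -> pi2 ∘ u = pi2 ∘ v -> u = v;
  cpair : forall X (a : cell X A) (b : cell X B), f ∗ a = g ∗ b -> cell X pb;
  cpair_pi1 : forall X (a : cell X A) (b : cell X B) (p : f ∗ a = g ∗ b),
    pi1 ∗ cpair p = a;
  cpair_pi2 : forall X (a : cell X A) (b : cell X B) (p : f ∗ a = g ∗ b),
    pi2 ∗ cpair p = b;
  cpair_uniq : forall X (u v : cell X pb),
    pi1 ∗ u = pi1 ∗ v -> pi2 ∗ u = pi2 ∗ v -> u = v
}.
Arguments pair {K A B Z f g} P {X} x y p : rename.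
Arguments cpair {K A B Z f g} P {X} a b p : rename.

Notation "⟨ x , y ⟩" := (pair _ x y _) : twocat_scope.
Notation "⟨ x , y , z ⟩" := (pair _ x (pair _ y z _) _) : twocat_scope.
Notation "⟪ a , b ⟫" := (cpair _ a b _) : twocat_scope.

(* The lemmas of this section only serve the tactic [bdry] below, which works with
   2-cells throughout: a 1-cell f is handled as its identity 2-cell. *)
Section Rules.
Context (K : twoCategory).

Lemma id2_inj (A B : K) (f g : hom A B) : id2 f = id2 g -> f = g.
Proof. by move=> p; rewrite -(src_id2 f) p src_id2. Qed.

Lemma hcomp_id2h (A B C X : K) (g : hom B C) (f : hom A B) (x : cell X A) :
  id2 (g ∘ f) ∗ x = g ∗ (f ∗ x).
Proof. by rewrite -hcomp_id2 hcompA. Qed.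

Lemma whisk (A B B' C : K) (f : cell B C) (a : cell A B)
    (g : cell B' C) (b : cell A B') :
  f ∗ a = g ∗ b -> forall X (x : cell X A), f ∗ (a ∗ x) = g ∗ (b ∗ x).
Proof. by move=> p X x; rewrite !hcompA p. Qed.

Lemma whisk1 (A B C : K) (f : cell B C) (a : cell A B) b :
  f ∗ a = b -> forall X (x : cell X A), f ∗ (a ∗ x) = b ∗ x.
Proof. by move=> p X x; rewrite !hcompA p. Qed.

Lemma whisk_id (A B : K) (f : cell B A) (a : cell A B) :
  f ∗ a = id2 id1 -> forall X (x : cell X A), f ∗ (a ∗ x) = x.
Proof. by move=> p X x; rewrite !hcompA p hcomp_idl. Qed.

Lemma id2h (A B C D : K) (f : hom B C) (a : hom A B) (g : hom D C) (b : hom A D) :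
  f ∘ a = g ∘ b -> f ∗ a = g ∗ b.
Proof. by move=> p; rewrite !hcomp_id2 p. Qed.

Lemma id2h1 (A B C : K) (f : hom B C) (a : hom A B) b :
  f ∘ a = b -> f ∗ a = id2 b.
Proof. by move=> p; rewrite !hcomp_id2 p. Qed.

Lemma id2_comp (A B C : K) (g : hom B C) (f : hom A B) : id2 (g ∘ f) = g ∗ f.
Proof. by rewrite hcomp_id2. Qed.

Lemma hcompA' (A B C D : K) (c : cell C D) (b : cell B C) (a : cell A B) :
  c ∗ b ∗ a = c ∗ (b ∗ a).
Proof. by rewrite hcompA. Qed.

Lemma vcomp_id (A B : K) (k : hom A B) (a : cell A B) p :
  k = tgt a -> vcomp (id2 k) a p = a.
Proof. by move=> e; move: p; rewrite e => p; apply: vcomp_idl. Qed.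

Lemma vcomp_id_r (A B : K) (k : hom A B) (a : cell A B) p :
  k = src a -> vcomp a (id2 k) p = a.
Proof. by move=> e; move: p; rewrite e => p; apply: vcomp_idr. Qed.

Lemma whisk_vcomp (A B C : K) (f : hom B C) (b a : cell A B) p k :
  f ∗ a = id2 k -> f ∗ b = id2 k -> f ∗ vcomp b a p = id2 k.
Proof.
move=> ea eb.
have q : src (id2 f) = tgt (id2 f) by rewrite src_id2 tgt_id2.
have r : src (f ∗ b) = tgt (f ∗ a) by rewrite !src_hcomp !tgt_hcomp p src_id2 tgt_id2.
have ef : vcomp (id2 f) (id2 f) q = f by apply: vcomp_id => //; rewrite tgt_id2.
rewrite -[X in hcomp X _]ef (interchange _ _ r).
move: r; rewrite ea eb => r.
by apply: vcomp_id => //; rewrite tgt_id2.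
Qed.


Lemma whisk_icV (A B C : K) (f : hom B C) (g h : hom A B) (a : g ≅ h) k :
  f ∗ a = id2 k -> f ∗ icV a = id2 k.
Proof.
move=> ea.
have q : src (id2 f) = tgt (id2 f) by rewrite src_id2 tgt_id2.
have r : src (f ∗ icV a) = tgt (f ∗ a)
  by rewrite !src_hcomp !tgt_hcomp src_id2 tgt_id2 (tc_comp (icV a) a).
have ef : vcomp (id2 f) (id2 f) q = f by apply: vcomp_id => //; rewrite tgt_id2.
have := interchange q (tc_comp (icV a) a) r.
rewrite ef icVl hcomp_id2.
have -> : f ∘ g = k.
  by rewrite -(tc_src a) -[RHS](src_id2 k) -ea src_hcomp src_id2.
move=> ->; move: r; rewrite ea => r.
by rewrite vcomp_id_r // r tgt_id2.
Qed.

Lemma pair_rules (A B Z X : K) (f : hom A Z) (g : hom B Z) (P : pullback f g)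
    (x : hom X A) (y : hom X B) (p : f ∘ x = g ∘ y) (u := pair P x y p) :
  ((pi1 P ∗ u = x) * (pi2 P ∗ u = y)
   * (forall V (h : cell V X), pi1 P ∗ (u ∗ h) = x ∗ h)
   * (forall V (h : cell V X), pi2 P ∗ (u ∗ h) = y ∗ h))%type.
Proof. by do !split=> *; rewrite ?hcompA hcomp_id2 ?pair_pi1 ?pair_pi2. Qed.

Lemma cpair_rules (A B Z X : K) (f : hom A Z) (g : hom B Z) (P : pullback f g)
    (a : cell X A) (b : cell X B) (p : f ∗ a = g ∗ b) (u := cpair P a b p) :
  ((pi1 P ∗ u = a) * (pi2 P ∗ u = b)
   * (forall V (h : cell V X), pi1 P ∗ (u ∗ h) = a ∗ h)
   * (forall V (h : cell V X), pi2 P ∗ (u ∗ h) = b ∗ h)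
   * (pi1 P ∗ src u = src a) * (pi2 P ∗ src u = src b)
   * (forall V (h : cell V X), pi1 P ∗ (src u ∗ h) = src a ∗ h)
   * (forall V (h : cell V X), pi2 P ∗ (src u ∗ h) = src b ∗ h)
   * (pi1 P ∗ tgt u = tgt a) * (pi2 P ∗ tgt u = tgt b)
   * (forall V (h : cell V X), pi1 P ∗ (tgt u ∗ h) = tgt a ∗ h)
   * (forall V (h : cell V X), pi2 P ∗ (tgt u ∗ h) = tgt b ∗ h))%type.
Proof.
have e1 : pi1 P ∗ u = a by apply: cpair_pi1.
have e2 : pi2 P ∗ u = b by apply: cpair_pi2.
have s1 : pi1 P ∘ src u = src a by rewrite -e1 src_hcomp src_id2.
have s2 : pi2 P ∘ src u = src b by rewrite -e2 src_hcomp src_id2.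
have t1 : pi1 P ∘ tgt u = tgt a by rewrite -e1 tgt_hcomp tgt_id2.
have t2 : pi2 P ∘ tgt u = tgt b by rewrite -e2 tgt_hcomp tgt_id2.
by do !split=> //; move=> *; rewrite ?hcompA ?hcomp_id2 ?s1 ?s2 ?t1 ?t2 ?e1 ?e2.
Qed.

Lemma pbE2 (A B Z : K) (f : hom A Z) (g : hom B Z) (P : pullback f g) :
  f ∗ pi1 P = g ∗ pi2 P.
Proof. by rewrite !hcomp_id2 pbE. Qed.

Lemma pbE2h (A B Z X : K) (f : hom A Z) (g : hom B Z) (P : pullback f g)
  (x : cell X P) : f ∗ (pi1 P ∗ x) = g ∗ (pi2 P ∗ x).
Proof. exact/whisk/pbE2. Qed.

End Rules.


Ltac gen_pair :=
  match goal with
  | |- context [@pair ?K ?A ?B ?Z ?f ?g ?P ?X ?x ?y ?e] =>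
    have := @pair_rules K A B Z X f g P x y e;
    generalize (@pair K A B Z f g P X x y e);
    let u := fresh "u" in let H := fresh "H" in move=> u /= H
  | |- context [@cpair ?K ?A ?B ?Z ?f ?g ?P ?X ?a ?b ?e] =>
    have := @cpair_rules K A B Z X f g P a b e;
    generalize (@cpair K A B Z f g P X a b e);
    let u := fresh "u" in let H := fresh "H" in move=> u /= H
  end.

Ltac use_pair := match goal with H : prod _ _ |- _ => progress rewrite !H end.

Ltac same := match goal with |- ?x = ?y => constr_eq x y; exact eq_refl end.

Ltac peel :=
  match goal with
  | |- hcomp ?f ?x = hcomp ?f ?y => apply: (f_equal (hcomp f))
  end.

Ltac category_rules := progress rewrite ?(id2_comp, hcompA', hcomp_idl, hcomp_idr,
  src_hcomp, tgt_hcomp, src_id2, tgt_id2, src_vcomp, tgt_vcomp, tc_src, tc_tgt,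
  pbE2, pbE2h).
Ltac structure_rules := fail.

(* Proves the equations between 1-cells, or between 2-cells, that make the
   composites and pairings below meaningful. *)
Ltac bdry :=
  intros; rewrite ?(src_vcomp, tgt_vcomp);
  try match goal with |- @eq (hom _ _) _ _ => apply: id2_inj end;
  repeat first [ same | gen_pair | use_pair | category_rules | structure_rules
               | apply: cpair_uniq | peel ].

#[export] Obligation Tactic := bdry.
Unset Transparent Obligations.

(* Each structure below is split into successive records because later fields
   contain composites that exist only by the boundary conditions of earlier ones;
   the last record of each series adds the coherence conditions. *)

(* Objects and 1-cells of a pseudo-category.  The triple and quadruple pullbacks
   are the iterated ones C1 ×_C0 (C1 ×_C0 C1) and C1 ×_C0 (C1 ×_C0 (C1 ×_C0 C1)). *)
Record pseudoCat1 (K : twoCategory) := PseudoCat1 {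
  C0 : K;
  C1 : K;
  d : hom C1 C0;
  c : hom C1 C0;
  e : hom C0 C1;
  P2 : pullback d c;
  P3 : pullback d (c ∘ pi1 P2);
  P4 : pullback d (c ∘ pi1 P3);
  m : hom P2 C1;
  de : d ∘ e = id1;
  ce : c ∘ e = id1;
  dm : d ∘ m = d ∘ pi2 P2;
  cm : c ∘ m = c ∘ pi1 P2
}.
Arguments d {K p}.
Arguments c {K p}.
Arguments e {K p}.
Arguments m {K p}.

Definition deE K C := id2h1 (@de K C).
Definition ceE K C := id2h1 (@ce K C).
Definition dmE K C := id2h (@dm K C).
Definition cmE K C := id2h (@cm K C).
Definition deEh K C := whisk_id (@deE K C).
Definition ceEh K C := whisk_id (@ceE K C).
Definition dmEh K C := whisk (@dmE K C).
Definition cmEh K C := whisk (@cmE K C).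

Ltac rules1 := progress rewrite
  ?(deE, ceE, dmE, cmE, deEh, ceEh, dmEh, cmEh).
Ltac structure_rules ::= rules1.

Section Projections.
Context (K : twoCategory) (C : pseudoCat1 K).
Definition p1 : hom (P2 C) (C1 C) := pi1 (P2 C).
Definition p2 : hom (P2 C) (C1 C) := pi2 (P2 C).
Definition q1 : hom (P3 C) (C1 C) := pi1 (P3 C).
Definition q2 : hom (P3 C) (C1 C) := pi1 (P2 C) ∘ pi2 (P3 C).
Definition q3 : hom (P3 C) (C1 C) := pi2 (P2 C) ∘ pi2 (P3 C).
Definition r1 : hom (P4 C) (C1 C) := pi1 (P4 C).
Definition r2 : hom (P4 C) (C1 C) := pi1 (P3 C) ∘ pi2 (P4 C).
Definition r3 : hom (P4 C) (C1 C) := pi1 (P2 C) ∘ pi2 (P3 C) ∘ pi2 (P4 C).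
Definition r4 : hom (P4 C) (C1 C) := pi2 (P2 C) ∘ pi2 (P3 C) ∘ pi2 (P4 C).
End Projections.
Arguments p1 {K C}.
Arguments p2 {K C}.
Arguments q1 {K C}.
Arguments q2 {K C}.
Arguments q3 {K C}.
Arguments r1 {K C}.
Arguments r2 {K C}.
Arguments r3 {K C}.
Arguments r4 {K C}.

Ltac unfold1 := progress rewrite /p1 /p2 /q1 /q2 /q3 /r1 /r2 /r3 /r4.
Ltac structure_rules ::= first [rules1 | unfold1].

Program Definition one_m (K : twoCategory) (C : pseudoCat1 K) : hom (P3 C) (P2 C) :=
  ⟨q1, m ∘ ⟨q2, q3⟩⟩.
Program Definition m_one (K : twoCategory) (C : pseudoCat1 K) : hom (P3 C) (P2 C) :=
  ⟨m ∘ ⟨q1, q2⟩, q3⟩.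
Program Definition one_ed (K : twoCategory) (C : pseudoCat1 K) : hom (C1 C) (P2 C) :=
  ⟨id1, e ∘ d⟩.
Program Definition ec_one (K : twoCategory) (C : pseudoCat1 K) : hom (C1 C) (P2 C) :=
  ⟨e ∘ c, id1⟩.

Record pseudoCat2 (K : twoCategory) := PseudoCat2 {
  pc1 :> pseudoCat1 K;
  alpha : m ∘ one_m pc1 ≅ m ∘ m_one pc1;
  lambda : m ∘ ec_one pc1 ≅ id1;
  rho : m ∘ one_ed pc1 ≅ id1;
  d_lambda : d ∗ lambda = d;
  d_rho : d ∗ rho = d;
  c_lambda : c ∗ lambda = c;
  c_rho : c ∗ rho = c;
  d_alpha : d ∗ alpha = d ∘ q3;
  c_alpha : c ∗ alpha = c ∘ q1
}.
Arguments alpha {K p}.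
Arguments lambda {K p}.
Arguments rho {K p}.

Definition d_lambdah K C := whisk1 (@d_lambda K C).
Definition c_lambdah K C := whisk1 (@c_lambda K C).
Definition d_rhoh K C := whisk1 (@d_rho K C).
Definition c_rhoh K C := whisk1 (@c_rho K C).
Definition d_alphah K C := whisk1 (@d_alpha K C).
Definition c_alphah K C := whisk1 (@c_alpha K C).
Definition d_alphaV K C := whisk_icV (@d_alpha K C).
Definition c_alphaV K C := whisk_icV (@c_alpha K C).
Definition d_alphaVh K C := whisk1 (@d_alphaV K C).
Definition c_alphaVh K C := whisk1 (@c_alphaV K C).

Ltac unfold2 := progress rewrite /one_m /m_one /one_ed /ec_one.
Ltac rules2 := progress rewrite
  ?(d_lambda, d_rho, d_alpha, c_lambda, c_rho, c_alpha,
    d_lambdah, d_rhoh, d_alphah, c_lambdah, c_rhoh, c_alphah,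
    d_alphaV, c_alphaV, d_alphaVh, c_alphaVh).
Ltac structure_rules ::= first [rules1 | rules2 | unfold1 | unfold2].

Program Definition pentagon (K : twoCategory) (C : pseudoCat2 K) : Prop :=
  (alpha ∗ ⟨m ∘ ⟨r1, r2⟩, r3, r4⟩) • (alpha ∗ ⟨r1, r2, m ∘ ⟨r3, r4⟩⟩)
  = (m ∗ ⟪alpha ∗ ⟨r1, r2, r3⟩, r4⟫)
    • (alpha ∗ ⟨r1, m ∘ ⟨r2, r3⟩, r4⟩)
    • (m ∗ ⟪r1, alpha ∗ ⟨r2, r3, r4⟩⟫) :> cell (P4 C) (C1 C).

Program Definition triangle (K : twoCategory) (C : pseudoCat2 K) : Prop :=
  (m ∗ ⟪rho ∗ p1, p2⟫) • (alpha ∗ ⟨p1, e ∘ c ∘ p2, p2⟩) = m ∗ ⟪p1, lambda ∗ p2⟫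
  :> cell (P2 C) (C1 C).

Record pseudoCat (K : twoCategory) := PseudoCat {
  pc2 :> pseudoCat2 K;
  lambda_e : lambda ∗ e = rho ∗ e :> cell (C0 pc2) (C1 pc2);
  pc_pentagon : pentagon pc2;
  pc_triangle : triangle pc2
}.

Record pseudoFunctor1 (K : twoCategory) (C C' : pseudoCat K) := PseudoFunctor1 {
  fun0 : hom (C0 C) (C0 C');
  fun1 : hom (C1 C) (C1 C');
  d_fun : d ∘ fun1 = fun0 ∘ d;
  c_fun : c ∘ fun1 = fun0 ∘ c
}.

Definition d_funE K C C' F := id2h (@d_fun K C C' F).
Definition c_funE K C C' F := id2h (@c_fun K C C' F).
Definition d_funEh K C C' F := whisk (@d_funE K C C' F).
Definition c_funEh K C C' F := whisk (@c_funE K C C' F).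
Ltac rules3 := progress rewrite ?(d_funE, c_funE, d_funEh, c_funEh).
Ltac structure_rules ::= first [rules1 | rules2 | rules3 | unfold1 | unfold2].

Program Definition fun_fun (K : twoCategory) (C C' : pseudoCat K)
    (F : pseudoFunctor1 C C') : hom (P2 C) (P2 C') :=
  ⟨fun1 F ∘ p1, fun1 F ∘ p2⟩.

Record pseudoFunctor2 (K : twoCategory) (C C' : pseudoCat K) := PseudoFunctor2 {
  pf1 :> pseudoFunctor1 C C';
  mu : fun1 pf1 ∘ m ≅ m ∘ fun_fun pf1;
  eps : fun1 pf1 ∘ e ≅ e ∘ fun0 pf1;
  d_mu : d ∗ mu = fun0 pf1 ∘ d ∘ p2;
  c_mu : c ∗ mu = fun0 pf1 ∘ c ∘ p1;
  d_eps : d ∗ eps = fun0 pf1;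
  c_eps : c ∗ eps = fun0 pf1
}.

Definition d_muh K C C' F := whisk1 (@d_mu K C C' F).
Definition c_muh K C C' F := whisk1 (@c_mu K C C' F).
Definition d_epsh K C C' F := whisk1 (@d_eps K C C' F).
Definition c_epsh K C C' F := whisk1 (@c_eps K C C' F).
Definition d_muV K C C' F := whisk_icV (@d_mu K C C' F).
Definition c_muV K C C' F := whisk_icV (@c_mu K C C' F).
Definition d_muVh K C C' F := whisk1 (@d_muV K C C' F).
Definition c_muVh K C C' F := whisk1 (@c_muV K C C' F).
Ltac rules4 := progress rewrite ?(d_mu, c_mu, d_eps, c_eps, d_muV, c_muV,
  d_muh, c_muh, d_epsh, c_epsh, d_muVh, c_muVh).
Ltac unfold4 := progress rewrite /fun_fun.
Ltac structure_rules ::=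
  first [rules1 | rules2 | rules3 | rules4 | unfold1 | unfold2 | unfold4].

Program Definition functor_assoc (K : twoCategory) (C C' : pseudoCat K)
    (F : pseudoFunctor2 C C') : Prop :=
  (alpha ∗ ⟨fun1 F ∘ q1, fun1 F ∘ q2, fun1 F ∘ q3⟩)
    • (m ∗ ⟪fun1 F ∘ q1, mu F ∗ ⟨q2, q3⟩⟫)
    • (mu F ∗ one_m C)
  = (m ∗ ⟪mu F ∗ ⟨q1, q2⟩, fun1 F ∘ q3⟫)
    • (mu F ∗ m_one C)
    • (fun1 F ∗ alpha) :> cell (P3 C) (C1 C').

Program Definition functor_unit_r (K : twoCategory) (C C' : pseudoCat K)
    (F : pseudoFunctor2 C C') : Prop :=
  fun1 F ∗ rho
  = (rho ∗ fun1 F) • (m ∗ ⟪fun1 F, eps F ∗ d⟫) • (mu F ∗ one_ed C)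
  :> cell (C1 C) (C1 C').

Program Definition functor_unit_l (K : twoCategory) (C C' : pseudoCat K)
    (F : pseudoFunctor2 C C') : Prop :=
  fun1 F ∗ lambda
  = (lambda ∗ fun1 F) • (m ∗ ⟪eps F ∗ c, fun1 F⟫) • (mu F ∗ ec_one C)
  :> cell (C1 C) (C1 C').

Record pseudoFunctor (K : twoCategory) (C C' : pseudoCat K) := PseudoFunctor {
  pf2 :> pseudoFunctor2 C C';
  pf_assoc : functor_assoc pf2;
  pf_unit_r : functor_unit_r pf2;
  pf_unit_l : functor_unit_l pf2
}.

Record natTrans1 (K : twoCategory) (C C' : pseudoCat K) (F G : pseudoFunctor C C') :=
NatTrans1 {
  nat0 : fun0 F ⇒ fun0 G;
  nat1 : fun1 F ⇒ fun1 G;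
  d_nat : d ∗ nat1 = nat0 ∗ d;
  c_nat : c ∗ nat1 = nat0 ∗ c
}.

Definition d_nath K C C' F G t := whisk (@d_nat K C C' F G t).
Definition c_nath K C C' F G t := whisk (@c_nat K C C' F G t).
Ltac rules5 := progress rewrite ?(d_nat, c_nat, d_nath, c_nath).
Ltac structure_rules ::= first [rules1 | rules2 | rules3 | rules4 | rules5
  | unfold1 | unfold2 | unfold4].

Program Definition nat_mu (K : twoCategory) (C C' : pseudoCat K)
    (F G : pseudoFunctor C C') (θ : natTrans1 F G) : Prop :=
  mu G • (nat1 θ ∗ m) = (m ∗ ⟪nat1 θ ∗ p1, nat1 θ ∗ p2⟫) • mu F
  :> cell (P2 C) (C1 C').

Program Definition nat_eps (K : twoCategory) (C C' : pseudoCat K)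
    (F G : pseudoFunctor C C') (θ : natTrans1 F G) : Prop :=
  eps G • (nat1 θ ∗ e) = (e ∗ nat0 θ) • eps F :> cell (C0 C) (C1 C').

Record natTrans (K : twoCategory) (C C' : pseudoCat K) (F G : pseudoFunctor C C') :=
NatTrans {
  nt1 :> natTrans1 F G;
  nt_mu : nat_mu nt1;
  nt_eps : nat_eps nt1
}.

Record pseudoNat1 (K : twoCategory) (C C' : pseudoCat K) (F G : pseudoFunctor C C') :=
PseudoNat1 {
  pnt : hom (C0 C) (C1 C');
  d_pnt : d ∘ pnt = fun0 F;
  c_pnt : c ∘ pnt = fun0 G
}.

Definition d_pntE K C C' F G T := id2h1 (@d_pnt K C C' F G T).
Definition c_pntE K C C' F G T := id2h1 (@c_pnt K C C' F G T).
Definition d_pntEh K C C' F G T := whisk1 (@d_pntE K C C' F G T).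
Definition c_pntEh K C C' F G T := whisk1 (@c_pntE K C C' F G T).
Ltac rules6 := progress rewrite ?(d_pntE, c_pntE, d_pntEh, c_pntEh).
Ltac structure_rules ::= first [rules1 | rules2 | rules3 | rules4 | rules5 | rules6
  | unfold1 | unfold2 | unfold4].

Program Definition tau_src (K : twoCategory) (C C' : pseudoCat K)
    (F G : pseudoFunctor C C') (T : pseudoNat1 F G) : hom (C1 C) (C1 C') :=
  m ∘ ⟨fun1 G, pnt T ∘ d⟩.

Program Definition tau_tgt (K : twoCategory) (C C' : pseudoCat K)
    (F G : pseudoFunctor C C') (T : pseudoNat1 F G) : hom (C1 C) (C1 C') :=
  m ∘ ⟨pnt T ∘ c, fun1 F⟩.

(* The morphism and the 2-cell of a pseudo-natural transformation, with their
   boundaries but without invertibility and coherence.  Vertical composites and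
   pseudo-modifications depend on this part only, and are defined for it. *)
Record pseudoNat2 (K : twoCategory) (C C' : pseudoCat K) (F G : pseudoFunctor C C') :=
PseudoNat2 {
  pn1 :> pseudoNat1 F G;
  tau : tau_src pn1 ⇒ tau_tgt pn1;
  d_tau : d ∗ tau = d ∘ fun1 F;
  c_tau : c ∗ tau = c ∘ fun1 G
}.

Definition d_tauh K C C' F G T := whisk1 (@d_tau K C C' F G T).
Definition c_tauh K C C' F G T := whisk1 (@c_tau K C C' F G T).
Ltac rules7 := progress rewrite ?(d_tau, c_tau, d_tauh, c_tauh).
Ltac unfold7 := progress rewrite /tau_src /tau_tgt.
Ltac structure_rules ::= first [rules1 | rules2 | rules3 | rules4 | rules5 | rules6
  | rules7 | unfold1 | unfold2 | unfold4 | unfold7].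

Program Definition pn_comp_law (K : twoCategory) (C C' : pseudoCat K)
    (F G : pseudoFunctor C C') (T : pseudoNat2 F G) : Prop :=
  (alpha ∗ ⟨pnt T ∘ c ∘ p1, fun1 F ∘ p1, fun1 F ∘ p2⟩)
    • (m ∗ ⟪pnt T ∘ c ∘ p1, mu F⟫)
    • (tau T ∗ m)
    • (m ∗ ⟪icV (mu G), pnt T ∘ d ∘ p2⟫)
  = (m ∗ ⟪tau T ∗ p1, fun1 F ∘ p2⟫)
    • (alpha ∗ ⟨fun1 G ∘ p1, pnt T ∘ c ∘ p2, fun1 F ∘ p2⟩)
    • (m ∗ ⟪fun1 G ∘ p1, tau T ∗ p2⟫)
    • (icV alpha ∗ ⟨fun1 G ∘ p1, fun1 G ∘ p2, pnt T ∘ d ∘ p2⟩)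
  :> cell (P2 C) (C1 C').

Program Definition pn_unit_law (K : twoCategory) (C C' : pseudoCat K)
    (F G : pseudoFunctor C C') (T : pseudoNat2 F G) : Prop :=
  (lambda ∗ pnt T) • (m ∗ ⟪eps G, pnt T⟫)
  = (rho ∗ pnt T) • (m ∗ ⟪pnt T, eps F⟫) • (tau T ∗ e)
  :> cell (C0 C) (C1 C').

Record pseudoNat (K : twoCategory) (C C' : pseudoCat K) (F G : pseudoFunctor C C') :=
PseudoNat {
  pn2 :> pseudoNat2 F G;
  pn_invertible : invertible (tau pn2);
  pn_comp : pn_comp_law pn2;
  pn_unit : pn_unit_law pn2
}.

Program Definition comp_pn1 (K : twoCategory) (C C' : pseudoCat K)
    (F G H : pseudoFunctor C C') (S : pseudoNat1 G H) (T : pseudoNat1 F G) :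
    pseudoNat1 F H :=
  {| pnt := m ∘ ⟨pnt S, pnt T⟩ |}.

Program Definition comp_tau (K : twoCategory) (C C' : pseudoCat K)
    (F G H : pseudoFunctor C C') (S : pseudoNat2 G H) (T : pseudoNat2 F G) :
    cell (C1 C) (C1 C') :=
  (alpha ∗ ⟨pnt S ∘ c, pnt T ∘ c, fun1 F⟩)
    • (m ∗ ⟪pnt S ∘ c, tau T⟫)
    • (icV alpha ∗ ⟨pnt S ∘ c, fun1 G, pnt T ∘ d⟩)
    • (m ∗ ⟪tau S, pnt T ∘ d⟫)
    • (alpha ∗ ⟨fun1 H, pnt S ∘ d, pnt T ∘ d⟩).

Section CompTau.
Context (K : twoCategory) (C C' : pseudoCat K) (F G H : pseudoFunctor C C').
Context (S : pseudoNat2 G H) (T : pseudoNat2 F G).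

Lemma src_comp_tau : src (comp_tau S T) = tau_src (comp_pn1 S T).
Proof. by rewrite /comp_tau /tau_src /=; bdry. Qed.

Lemma tgt_comp_tau : tgt (comp_tau S T) = tau_tgt (comp_pn1 S T).
Proof. by rewrite /comp_tau /tau_tgt /=; bdry. Qed.

Lemma d_comp_tau : d ∗ comp_tau S T = d ∘ fun1 F.
Proof. by rewrite /comp_tau; do !apply: whisk_vcomp; bdry. Qed.

Lemma c_comp_tau : c ∗ comp_tau S T = c ∘ fun1 H.
Proof. by rewrite /comp_tau; do !apply: whisk_vcomp; bdry. Qed.

Definition comp_pn : pseudoNat2 F H :=
  @PseudoNat2 K C C' F H (comp_pn1 S T) (TCell src_comp_tau tgt_comp_tau)
    d_comp_tau c_comp_tau.
End CompTau.

Notation "S ⊗ T" := (comp_pn S T) (at level 40, left associativity) : twocat_scope.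

(* A pseudo-modification from T to T' with boundary (θ, θ'). *)
Record pseudoMod1 (K : twoCategory) (C C' : pseudoCat K)
    (F G F' G' : pseudoFunctor C C') (T : pseudoNat2 F G) (T' : pseudoNat2 F' G')
    (θ : natTrans F F') (θ' : natTrans G G') := PseudoMod1 {
  pm :> pnt T ⇒ pnt T';
  d_pm : d ∗ pm = nat0 θ;
  c_pm : c ∗ pm = nat0 θ'
}.

Definition d_pmh K C C' F G F' G' T T' θ θ' Φ :=
  whisk1 (@d_pm K C C' F G F' G' T T' θ θ' Φ).
Definition c_pmh K C C' F G F' G' T T' θ θ' Φ :=
  whisk1 (@c_pm K C C' F G F' G' T T' θ θ' Φ).
Ltac rules8 := progress rewrite ?(d_pm, c_pm, d_pmh, c_pmh).
Ltac structure_rules ::= first [rules1 | rules2 | rules3 | rules4 | rules5 | rules6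
  | rules7 | rules8 | unfold1 | unfold2 | unfold4 | unfold7].

Program Definition pm_law (K : twoCategory) (C C' : pseudoCat K)
    (F G F' G' : pseudoFunctor C C') (T : pseudoNat2 F G) (T' : pseudoNat2 F' G')
    (θ : natTrans F F') (θ' : natTrans G G') (Φ : pseudoMod1 T T' θ θ') : Prop :=
  tau T' • (m ∗ ⟪nat1 θ', Φ ∗ d⟫) = (m ∗ ⟪Φ ∗ c, nat1 θ⟫) • tau T
  :> cell (C1 C) (C1 C').

Record pseudoMod (K : twoCategory) (C C' : pseudoCat K)
    (F G F' G' : pseudoFunctor C C') (T : pseudoNat2 F G) (T' : pseudoNat2 F' G')
    (θ : natTrans F F') (θ' : natTrans G G') := PseudoMod {
  pm1 :> pseudoMod1 T T' θ θ';
  pm_nat : pm_law pm1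
}.

(* The 2-cell Φ underlies a pseudo-modification from T to T' with boundary (θ, θ'). *)
Definition is_pseudoMod (K : twoCategory) (C C' : pseudoCat K)
    (F G F' G' : pseudoFunctor C C') (T : pseudoNat2 F G) (T' : pseudoNat2 F' G')
    (θ : natTrans F F') (θ' : natTrans G G') (Φ : cell (C0 C) (C1 C')) : Prop :=
  exists Φ' : pseudoMod T T' θ θ', Φ = Φ'.

Program Definition comp_pm (K : twoCategory) (C C' : pseudoCat K)
    (F G H F' G' H' : pseudoFunctor C C')
    (T : pseudoNat2 F G) (S : pseudoNat2 G H)
    (T' : pseudoNat2 F' G') (S' : pseudoNat2 G' H')
    (θ : natTrans F F') (θ' : natTrans G G') (θ'' : natTrans H H')
    (Ψ : pseudoMod S S' θ' θ'') (Φ : pseudoMod T T' θ θ') :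
    cell (C0 C) (C1 C') :=
  m ∗ ⟪Ψ, Φ⟫.

(* Main.v *)
From Corelib Require Import ssreflect.
Require Import Defs.
Local Open Scope twocat_scope.
Set Implicit Arguments.
Unset Strict Implicit.
Unset Printing Implicit Defensive.

(** The boundary equations for [m ∗ ⟪Ψ, Φ⟫] are immediate from those of [Ψ] and
[Φ], so the content is compatibility with the 2-cells [tau].  It is read as a
commuting square with columns [comp_tau S T] and [comp_tau S' T'] and rows
[m ∗ ⟪θ'', m ∗ ⟪Ψ, Φ⟫ ∗ d⟫] and [m ∗ ⟪m ∗ ⟪Ψ, Φ⟫ ∗ c, θ⟫].  Each column is a
vertical composite of five 2-cells, and the square is pasted from five squares,
one for each factor:
- the three factors built from the associator, or its inverse, contribute
  naturality squares, which hold by interchange ([square_nat]);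
- the factor [m ∗ ⟪tau S, pnt T ∘ d⟫] contributes the compatibility square of
  [Ψ] paired with the square for the horizontal cell [Φ ∗ d], and likewise
  [m ∗ ⟪pnt S ∘ c, tau T⟫] contributes the pair of [Ψ ∗ c] with the
  compatibility square of [Φ].

The rows met on the way are [m ∘ one_m] or [m ∘ m_one] applied to the triples
[(θ'', Ψ d, Φ d)], [(Ψ c, θ', Φ d)] and [(Ψ c, Φ c, θ)]: the square of [Ψ]
exchanges the pair [(θ'', Ψ d)] for [(Ψ c, θ')], and that of [Φ] exchanges
[(θ', Φ d)] for [(Φ c, θ)]. *)

Section Squares.
Context (K : twoCategory).

(** Associativity in [twoCategory] holds for all proofs of composability, so
composing with an identity lets one such proof be exchanged for another, without
proof irrelevance for equality of 1-cells. *)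
Lemma vcomp_irr (A B : K) (b a : cell A B) (p q : src b = tgt a) :
  vcomp b a p = vcomp b a q.
Proof.
have i : src (id2 (tgt b)) = tgt b by rewrite src_id2.
have eb : vcomp (id2 (tgt b)) b i = b by apply: vcomp_id.
have r : src (id2 (tgt b)) = tgt (vcomp b a p) by rewrite src_id2 tgt_vcomp.
rewrite -[LHS](vcomp_id (k := tgt b) r) ?tgt_vcomp //.
have assoc s := vcompA (p := p) (q := i) r s.
by move: assoc; rewrite eb; apply.
Qed.

(** The commuting square with columns [x], [x'] and rows [u], [v].  Composability
is part of the proposition, so that squares can be transformed without carrying
their boundary equations along. *)
Definition square (A B : K) (x' u v x : cell A B) : Prop :=
  exists p q, vcomp x' u p = vcomp v x q.

Lemma square_intro (A B : K) (x' u v x : cell A B) p q :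
  vcomp x' u p = vcomp v x q -> square x' u v x.
Proof. by move=> E; exists p, q. Qed.

Lemma squareE (A B : K) (x' u v x : cell A B) p q :
  square x' u v x -> vcomp x' u p = vcomp v x q.
Proof.
by move=> [p' [q' E]]; rewrite (vcomp_irr p p') E; apply: vcomp_irr.
Qed.

Lemma square_vcomp (A B : K) (y' x' u v w y x : cell A B) p' p :
  square y' v w y -> square x' u v x ->
  square (vcomp y' x' p') u w (vcomp y x p).
Proof.
move=> [a [b E]] [a1 [b1 E1]].
have h1 : src (vcomp y' x' p') = tgt u by rewrite src_vcomp.
have h2 : src w = tgt (vcomp y x p) by rewrite tgt_vcomp.
have h3 : src y' = tgt (vcomp x' u a1) by rewrite tgt_vcomp.
have h4 : src (vcomp w y b) = tgt x by rewrite src_vcomp.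
exists h1, h2.
rewrite -(vcompA (p := a1) (q := p') h3) (vcompA (p := p) (q := b) h2 h4).
move: h3 h4; rewrite E1 -E => h3 h4.
exact: vcompA.
Qed.

Lemma square_hcomp (A B D : K) (y' u2 v2 y : cell B D) (x' u v x : cell A B) :
  square y' u2 v2 y -> square x' u v x ->
  square (y' ∗ x') (u2 ∗ u) (v2 ∗ v) (y ∗ x).
Proof.
move=> [a [b E]] [a1 [b1 E1]].
have h1 : src (y' ∗ x') = tgt (u2 ∗ u) by rewrite src_hcomp tgt_hcomp a a1.
have h2 : src (v2 ∗ v) = tgt (y ∗ x) by rewrite src_hcomp tgt_hcomp b b1.
by exists h1, h2; rewrite -(interchange a a1) E E1 (interchange b b1 h2).
Qed.

Lemma square_id_rows (A B : K) (f g : hom A B) (a : f ⇒ g) : square g a a f.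
Proof.
have h1 : src (id2 g) = tgt a by rewrite src_id2 tc_tgt.
have h2 : src a = tgt (id2 f) by rewrite tgt_id2 tc_src.
by exists h1, h2; rewrite vcomp_id ?tc_tgt // vcomp_id_r ?tc_src.
Qed.

Lemma square_id_columns (A B : K) (f g : hom A B) (a : f ⇒ g) : square a f g a.
Proof.
have h1 : src (id2 g) = tgt a by rewrite src_id2 tc_tgt.
have h2 : src a = tgt (id2 f) by rewrite tgt_id2 tc_src.
by exists h2, h1; rewrite vcomp_id ?tc_tgt // vcomp_id_r ?tc_src.
Qed.

Lemma square_whisk (A B D : K) (g : hom B D) (x' u v x : cell A B) :
  square x' u v x -> square (g ∗ x') (g ∗ u) (g ∗ v) (g ∗ x).
Proof. exact/square_hcomp/(square_id_rows (TCell (src_id2 g) (tgt_id2 g))). Qed.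

Lemma square_whiskr (A B D : K) (f : hom A B) (x' u v x : cell B D) :
  square x' u v x -> square (x' ∗ f) (u ∗ f) (v ∗ f) (x ∗ f).
Proof.
move=> h.
exact/(square_hcomp h)/(square_id_rows (TCell (src_id2 f) (tgt_id2 f))).
Qed.

(** Naturality of whiskering is the horizontal composite of the two degenerate
squares on [a] and on [w]. *)
Lemma square_nat (A B D : K) (f g : hom B D) (a : f ⇒ g)
    (h k : hom A B) (w : cell A B) : src w = h -> tgt w = k ->
  square (a ∗ k) (f ∗ w) (g ∗ w) (a ∗ h).
Proof.
move=> eh ek.
exact: (square_hcomp (square_id_columns a) (square_id_rows (TCell eh ek))).
Qed.

(** Universality of the pullback for 2-cells: composability is detected by the
projections through [pair_uniq], the equation through [cpair_uniq]. *)
Lemma square_pair (X A B Z : K) (f : hom A Z) (g : hom B Z) (P : pullback f g)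
    (x' u v x : cell X P) :
  square (pi1 P ∗ x') (pi1 P ∗ u) (pi1 P ∗ v) (pi1 P ∗ x) ->
  square (pi2 P ∗ x') (pi2 P ∗ u) (pi2 P ∗ v) (pi2 P ∗ x) ->
  square x' u v x.
Proof.
have src2 Y (k : hom P Y) (y : cell X P) : src (k ∗ y) = k ∘ src y.
  by rewrite src_hcomp src_id2.
have tgt2 Y (k : hom P Y) (y : cell X P) : tgt (k ∗ y) = k ∘ tgt y.
  by rewrite tgt_hcomp tgt_id2.
move=> s1 s2; case: (s1) (s2) => [a1 [b1 _]] [a2 [b2 _]].
have h1 : src x' = tgt u by apply: pair_uniq; rewrite -src2 -tgt2.
have h2 : src v = tgt x by apply: pair_uniq; rewrite -src2 -tgt2.
have distr Y (k : hom P Y) (b a : cell X P) p (q : src (k ∗ b) = tgt (k ∗ a)) :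
    k ∗ vcomp b a p = vcomp (k ∗ b) (k ∗ a) q.
  have i : src (id2 k) = tgt (id2 k) by rewrite src_id2 tgt_id2.
  by rewrite -(interchange i p) vcomp_id ?tgt_id2.
have l1 Y (k : hom P Y) : src (k ∗ x') = tgt (k ∗ u) by rewrite src2 tgt2 h1.
have l2 Y (k : hom P Y) : src (k ∗ v) = tgt (k ∗ x) by rewrite src2 tgt2 h2.
exists h1, h2.
by apply: cpair_uniq; rewrite (distr _ _ _ _ _ (l1 _ _)) (distr _ _ _ _ _ (l2 _ _));
  apply: squareE.
Qed.

End Squares.

Lemma cpair_eq (K : twoCategory) (X A B Z : K) (f : hom A Z) (g : hom B Z)
    (P : pullback f g) (a : cell X A) (b : cell X B) (u : cell X P)
    (p : f ∗ a = g ∗ b) :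
  pi1 P ∗ u = a -> pi2 P ∗ u = b -> cpair P a b p = u.
Proof. by move=> ua ub; apply: cpair_uniq; rewrite ?cpair_pi1 ?cpair_pi2. Qed.

(** The rows are given by their projections rather than as pairings, so that the
square applies to whatever form they take inside a larger pasting. *)
Lemma pm_square (K : twoCategory) (C C' : pseudoCat K)
    (F G F' G' : pseudoFunctor C C') (T : pseudoNat2 F G) (T' : pseudoNat2 F' G')
    (θ : natTrans F F') (θ' : natTrans G G') (Φ : pseudoMod T T' θ θ') u v :
  pi1 (P2 C') ∗ u = nat1 θ' -> pi2 (P2 C') ∗ u = Φ ∗ d ->
  pi1 (P2 C') ∗ v = Φ ∗ c -> pi2 (P2 C') ∗ v = nat1 θ ->
  square (tau T') (m ∗ u) (m ∗ v) (tau T).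
Proof.
move=> u1 u2 v1 v2.
have := pm_nat Φ; rewrite /pm_law => /square_intro.
by rewrite (cpair_eq _ u1 u2) (cpair_eq _ v1 v2).
Qed.

Program Definition p12 (K : twoCategory) (C : pseudoCat K) : hom (P3 C) (P2 C) :=
  ⟨q1, q2⟩.

Section MOne.
Context (K : twoCategory) (C : pseudoCat K) (X : K) (w : cell X (P3 C)).

Lemma pi1_m_one : pi1 (P2 C) ∗ (m_one C ∗ w) = m ∗ (p12 C ∗ w).
Proof. by rewrite /p12; bdry. Qed.

Lemma pi2_m_one : pi2 (P2 C) ∗ (m_one C ∗ w) = q3 ∗ w.
Proof. by bdry. Qed.

Lemma pi1_one_m : pi1 (P2 C) ∗ (one_m C ∗ w) = q1 ∗ w.
Proof. by bdry. Qed.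

Lemma pi2_one_m : pi2 (P2 C) ∗ (one_m C ∗ w) = m ∗ (pi2 (P3 C) ∗ w).
Proof. by bdry. Qed.
End MOne.

Section Composite.
Context (K : twoCategory) (C C' : pseudoCat K) (F G H F' G' H' : pseudoFunctor C C').
Context (T : pseudoNat2 F G) (S : pseudoNat2 G H).
Context (T' : pseudoNat2 F' G') (S' : pseudoNat2 G' H').
Context (θ : natTrans F F') (θ' : natTrans G G') (θ'' : natTrans H H').
Context (Φ : pseudoMod T T' θ θ') (Ψ : pseudoMod S S' θ' θ'').

Lemma src_comp_pm : src (comp_pm Ψ Φ) = pnt (S ⊗ T).
Proof. by rewrite /comp_pm /=; bdry. Qed.

Lemma tgt_comp_pm : tgt (comp_pm Ψ Φ) = pnt (S' ⊗ T').
Proof. by rewrite /comp_pm /=; bdry. Qed.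

Lemma d_comp_pm : d ∗ comp_pm Ψ Φ = nat0 θ.
Proof. by rewrite /comp_pm; bdry. Qed.

Lemma c_comp_pm : c ∗ comp_pm Ψ Φ = nat0 θ''.
Proof. by rewrite /comp_pm; bdry. Qed.

Definition comp_pm1 : pseudoMod1 (S ⊗ T) (S' ⊗ T') θ θ'' :=
  @PseudoMod1 K C C' F H F' H' (S ⊗ T) (S' ⊗ T') θ θ''
    (TCell src_comp_pm tgt_comp_pm) d_comp_pm c_comp_pm.

(** The three triples from which every row of the pasting is built.  The letters in
their names tell whether [Ψ] and [Φ] are still taken along [d] or already along
[c], that is, which of the two squares has been crossed. *)
Program Definition strip_dd : cell (C1 C) (P3 C') :=
  ⟪nat1 θ'', ⟪Ψ ∗ d, Φ ∗ d⟫⟫.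

Program Definition strip_cd : cell (C1 C) (P3 C') :=
  ⟪Ψ ∗ c, ⟪nat1 θ', Φ ∗ d⟫⟫.

Program Definition strip_cc : cell (C1 C) (P3 C') :=
  ⟪Ψ ∗ c, ⟪Φ ∗ c, nat1 θ⟫⟫.

(** The five squares are pasted starting from the first 2-cell of [comp_tau].  In
the second and the fourth, the common [m] is removed and the two components of
the pairing are treated separately. *)
Lemma comp_tau_square :
  square (comp_tau S' T') (m ∘ one_m C' ∗ strip_dd) (m ∘ m_one C' ∗ strip_cc)
    (comp_tau S T).
Proof.
rewrite /comp_tau.
apply: (square_vcomp (v := m ∘ m_one C' ∗ strip_dd)); last first.
  by apply: square_nat; rewrite /strip_dd; bdry.
apply: (square_vcomp (v := m ∘ m_one C' ∗ strip_cd)); last first.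
  rewrite !hcomp_id2h; apply/square_whisk/square_pair.
    rewrite cpair_pi1 cpair_pi1 !pi1_m_one.
    by apply: (pm_square (Φ := Ψ)); rewrite /strip_dd /strip_cd /p12; bdry.
  rewrite cpair_pi2 cpair_pi2 !pi2_m_one.
  have -> : q3 ∗ strip_dd = Φ ∗ d by rewrite /strip_dd; bdry.
  have -> : q3 ∗ strip_cd = Φ ∗ d by rewrite /strip_cd; bdry.
  rewrite -!hcomp_id2; exact/square_whiskr/square_id_rows.
apply: (square_vcomp (v := m ∘ one_m C' ∗ strip_cd)); last first.
  by apply: square_nat; rewrite /strip_cd; bdry.
apply: (square_vcomp (v := m ∘ one_m C' ∗ strip_cc)); last first.
  rewrite !hcomp_id2h; apply/square_whisk/square_pair.
    rewrite cpair_pi1 cpair_pi1 !pi1_one_m.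
    have -> : q1 ∗ strip_cd = Ψ ∗ c by rewrite /strip_cd; bdry.
    have -> : q1 ∗ strip_cc = Ψ ∗ c by rewrite /strip_cc; bdry.
    rewrite -!hcomp_id2; exact/square_whiskr/square_id_rows.
  rewrite cpair_pi2 cpair_pi2 !pi2_one_m.
  by apply: (pm_square (Φ := Φ)); rewrite /strip_cd /strip_cc; bdry.
by apply: square_nat; rewrite /strip_cc; bdry.
Qed.

Lemma comp_pm_law : pm_law comp_pm1.
Proof.
rewrite /pm_law; apply: squareE.
have e1 p : m ∗ cpair (P2 C') (nat1 θ'') (comp_pm1 ∗ d) p = m ∘ one_m C' ∗ strip_dd.
  by rewrite /= /comp_pm /strip_dd; bdry.
have e2 p : m ∗ cpair (P2 C') (comp_pm1 ∗ c) (nat1 θ) p = m ∘ m_one C' ∗ strip_cc.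
  by rewrite /= /comp_pm /strip_cc; bdry.
rewrite e1 e2; exact: comp_tau_square.
Qed.
End Composite.

Theorem proposition2 (K : twoCategory) (C C' : pseudoCat K)
    (F G H F' G' H' : pseudoFunctor C C')
    (T : pseudoNat F G) (S : pseudoNat G H)
    (T' : pseudoNat F' G') (S' : pseudoNat G' H')
    (θ : natTrans F F') (θ' : natTrans G G') (θ'' : natTrans H H')
    (Φ : pseudoMod T T' θ θ') (Ψ : pseudoMod S S' θ' θ'') :
  is_pseudoMod (S ⊗ T) (S' ⊗ T') θ θ'' (comp_pm Ψ Φ).
Proof. by exists (PseudoMod (comp_pm_law Φ Ψ)). Qed.
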